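(* Let $n>1$ be an integer and let $B(1,n)=\langle a,b : a^{-1}ba=b^n\rangle$ be the Baumslag–Solitar group. For any two injective endomorphisms $\phi$ and $\psi$ of $B(1,n)$, the Reidemeister number $R(\phi,\psi)$ is infinite.
   Context: For endomorphisms $\phi,\psi$ of a group $G$, two elements $x,x'\in G$ are called $(\phi,\psi)$-conjugate if there exists $\gamma\in G$ with $x'=\psi(\gamma)\,x\,\phi(\gamma)^{-1}$; this is an equivalence relation, and $R(\phi,\psi)$ denotes the number of $(\phi,\psi)$-conjugacy classes in $G$. *)

(* Defs.v *)
From HB Require Import structures.
From mathcomp Require Import all_boot.
From mathcomp Require Import boolp classical_sets functions cardinality.

Set Implicit Arguments.
Unset Strict Implicit.
Unset Printing Implicit Defensive.

Local Open Scope quotient_scope.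
Local Open Scope classical_set_scope.
Local Open Scope group_scope.

Section Words.
Variable X : choiceType.

(* A letter (x, false) stands for the generator x, (x, true) for x^-1. *)
Definition word := seq (X * bool).

Definition flip (l : X * bool) : X * bool := (l.1, ~~ l.2).
Definition winv (w : word) : word := rev (map flip w).

Variable rels : word -> word -> Prop.

(* The least congruence on words that contains the given relations and makes
   each letter cancel with its formal inverse. *)
Inductive pres_eq : word -> word -> Prop :=
| pres_refl u : pres_eq u u
| pres_sym u v : pres_eq u v -> pres_eq v u
| pres_trans u v w : pres_eq u v -> pres_eq v w -> pres_eq u w
| pres_cat u u' v v' :
    pres_eq u u' -> pres_eq v v' -> pres_eq (u ++ v) (u' ++ v')
| pres_cancel l : pres_eq [:: l; flip l] [::]
| pres_rel u v : rels u v -> pres_eq u v.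

Definition pres_eqb (u v : word) : bool := `[< pres_eq u v >].

Lemma pres_eqb_refl : reflexive pres_eqb.
Proof. by move=> u; apply/asboolP; exact: pres_refl. Qed.

Lemma pres_eqb_sym : symmetric pres_eqb.
Proof. by move=> u v; apply/asboolP/asboolP; exact: pres_sym. Qed.

Lemma pres_eqb_trans : transitive pres_eqb.
Proof.
move=> v u w /asboolP uv /asboolP vw; apply/asboolP.
exact: pres_trans uv vw.
Qed.

Canonical pres_equiv :=
  EquivRel pres_eqb pres_eqb_refl pres_eqb_sym pres_eqb_trans.

Definition presented : Type := {eq_quot pres_equiv}.

HB.instance Definition _ := Choice.on presented.
HB.instance Definition _ := EqQuotient.on presented.

End Words.

Section PresentedGroup.
Variables (X : choiceType) (rels : word X -> word X -> Prop).
Local Notation W := (word X).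
Local Notation G := (presented rels).
Implicit Types (u v w : W) (x y z : G).

Definition pcl (w : W) : G := \pi_G w.

Lemma pclP u v : (pcl u = pcl v) <-> pres_eq rels u v.
Proof.
split; first by move/eqmodP/asboolP.
by move=> uv; apply/eqmodP/asboolP.
Qed.

Lemma pcl_repr x : pcl (repr x) = x.
Proof. exact: reprK. Qed.

Lemma repr_pcl w : pres_eq rels (repr (pcl w)) w.
Proof. by apply/pclP; rewrite pcl_repr. Qed.

Lemma flipK : involutive (@flip X).
Proof. by case=> a b; rewrite /flip /= negbK. Qed.

Lemma winvK : involutive (@winv X).
Proof. by move=> w; rewrite /winv map_rev revK mapK //; exact: flipK. Qed.

Lemma winv_cat u v : winv (u ++ v) = winv v ++ winv u.
Proof. by rewrite /winv map_cat rev_cat. Qed.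

Lemma pres_mulV w : pres_eq rels (w ++ winv w) [::].
Proof.
elim: w => [|l w IH]; first exact: pres_refl.
rewrite -cat1s winv_cat -!catA (catA w).
apply: pres_trans (pres_cancel rels l).
rewrite -[X in pres_eq _ _ X]/([:: l] ++ ([::] ++ [:: flip l])).
by apply: pres_cat; [exact: pres_refl|apply: pres_cat => //; exact: pres_refl].
Qed.

Lemma pres_mulI w : pres_eq rels (winv w ++ w) [::].
Proof. by have := pres_mulV (winv w); rewrite winvK. Qed.

Lemma pres_inv u v : pres_eq rels u v -> pres_eq rels (winv u) (winv v).
Proof.
move=> uv; apply: (@pres_trans _ _ _ (winv u ++ v ++ winv v)).
  rewrite -[X in pres_eq _ X _]cats0; apply: pres_cat; first exact: pres_refl.
  exact/pres_sym/pres_mulV.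
rewrite catA -[X in pres_eq _ _ X]cat0s.
apply: pres_cat; last exact: pres_refl.
apply: pres_trans (pres_mulI u).
by apply: pres_cat; [exact: pres_refl|exact: pres_sym].
Qed.

Definition pmul x y : G := pcl (repr x ++ repr y).
Definition pinv x : G := pcl (winv (repr x)).

Lemma pmul_pcl u v : pmul (pcl u) (pcl v) = pcl (u ++ v).
Proof. by apply/pclP; apply: pres_cat; exact: repr_pcl. Qed.

Lemma pinv_pcl w : pinv (pcl w) = pcl (winv w).
Proof. by apply/pclP/pres_inv; exact: repr_pcl. Qed.

Lemma pmulA : associative pmul.
Proof.
move=> x y z; rewrite -(pcl_repr x) -(pcl_repr y) -(pcl_repr z).
by rewrite !pmul_pcl catA.
Qed.

Lemma pmul1g : left_id (pcl [::]) pmul.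
Proof. by move=> x; rewrite -(pcl_repr x) pmul_pcl. Qed.

Lemma pmulg1 : right_id (pcl [::]) pmul.
Proof. by move=> x; rewrite -(pcl_repr x) pmul_pcl cats0. Qed.

Lemma pmulVg : left_inverse (pcl [::]) pinv pmul.
Proof.
move=> x; rewrite -(pcl_repr x) pinv_pcl pmul_pcl.
exact/pclP/pres_mulI.
Qed.

Lemma pmulgV : right_inverse (pcl [::]) pinv pmul.
Proof.
move=> x; rewrite -(pcl_repr x) pinv_pcl pmul_pcl.
exact/pclP/pres_mulV.
Qed.

HB.instance Definition _ :=
  isGroup.Build G pmulA pmul1g pmulg1 pmulVg pmulgV.

Lemma pclM u v : pcl (u ++ v) = pcl u * pcl v.
Proof. by rewrite -pmul_pcl. Qed.

Lemma pclV w : pcl (winv w) = (pcl w)^-1.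
Proof. by rewrite -pinv_pcl. Qed.

Definition pgen (a : X) : G := pcl [:: (a, false)].

Section Lift.
Variables (H : groupType) (f : X -> H).

Definition weval (w : W) : H :=
  foldr (fun l h => (if l.2 then (f l.1)^-1 else f l.1) * h) 1 w.

Lemma weval_cat u v : weval (u ++ v) = weval u * weval v.
Proof. by elim: u => [|l u IH] /=; rewrite ?mul1g // IH mulgA. Qed.

Hypothesis f_rels : forall u v, rels u v -> weval u = weval v.

Lemma weval_pres u v : pres_eq rels u v -> weval u = weval v.
Proof.
elim=> // {u v}.
- by move=> u v w _ -> _ ->.
- by move=> u u' v v' _ e _ e'; rewrite !weval_cat e e'.
- by case=> a [] /=; rewrite mulg1 ?mulVg ?mulgV.
Qed.

Lemma pres_universal :
  exists! F : G -> H, {morph F : x y / x * y} /\ forall a, F (pgen a) = f a.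
Proof.
exists (fun x => weval (repr x)); split.
  split=> [x y|a].
    by rewrite -weval_cat; apply: weval_pres; exact: repr_pcl.
  by rewrite (weval_pres (repr_pcl _)) /= mulg1.
move=> F [FM Fg]; apply: funext => x; rewrite -{2}(pcl_repr x).
have F1 : F 1 = 1 by apply: (@mulgI _ (F 1)); rewrite -FM !mulg1.
have FV y : F y^-1 = (F y)^-1.
  by apply: (@mulgI _ (F y)); rewrite -FM !mulgV.
elim: (repr x) => [|[a []] w IH] /=; first exact: esym F1.
  rewrite -cat1s pclM FM -IH; congr (_ * _).
  by rewrite -Fg -FV -pclV.
by rewrite -cat1s pclM FM -IH -Fg.
Qed.

End Lift.
End PresentedGroup.

(* The two generators: true is a, false is b. *)
Definition BS_rels (n : nat) (u v : word bool) : Prop :=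
  u = [:: (true, true); (false, false); (true, false)] /\
  v = nseq n (false, false).

Definition BS (n : nat) : groupType := presented (BS_rels n).
Definition BSa (n : nat) : BS n := pgen (BS_rels n) true.
Definition BSb (n : nat) : BS n := pgen (BS_rels n) false.

Lemma BS_relation n : (BSa n)^-1 * BSb n * BSa n = BSb n ^+ n.
Proof.
have bX k : BSb n ^+ k = pcl (BS_rels n) (nseq k (false, false)).
  by elim: k => // k IH; rewrite expgS IH -pclM.
rewrite bX -pclV; transitivity (pcl (BS_rels n)
    ((winv [:: (true, false)] ++ [:: (false, false)]) ++ [:: (true, false)])).
  by rewrite !pclM.
by apply/pclP/pres_rel; split.
Qed.

Section Reidemeister.
Variables (G : groupType) (phi psi : G -> G).

Definition twisted_conj (x x' : G) : Prop :=
  exists g : G, x' = psi g * x * (phi g)^-1.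

Definition reidemeister_classes : set (set G) :=
  range (fun x : G => [set x' | twisted_conj x x']).

End Reidemeister.

(* Main.v *)
Require Import Defs.
From HB Require Import structures.
From mathcomp Require Import all_boot all_order all_algebra.
From mathcomp Require Import boolp classical_sets functions cardinality.

(** The group BS n embeds in the affine group of the rational line, a acting as
    the homothety of ratio n and b as the translation by 1. Write (k, x) for
    the affine map of ratio n ^ k and translation part x. An injective
    endomorphism phi preserves the exponent k: it sends b to an element of some
    exponent t and a to one of some exponent k, and the image of the relation
    a^-1 b a = b^n forces first t = n t, so phi b is a translation by some x,
    then x n^k = n x. As phi b <> 1 and the affine representation is faithful,
    x <> 0, hence k = 1. Since phi and psi both preserve the exponent, which is
    a homomorphism to the commutative group of integers, x and
    psi g * x * (phi g)^-1 have the same exponent. The exponent is thus an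
    invariant of (phi, psi)-conjugacy, and it separates the powers of a.

    Faithfulness ([affine_rep]) comes from the normal form a^i b^m a^-j, m an
    integer ([BS_normal_form]): the affine map attached to it has exponent
    i - j and translation part m / n^j, and so is trivial only if i = j and
    m = 0. The computation of exponents is [inj_endo_exponent]. *)

Set Implicit Arguments.
Unset Strict Implicit.
Unset Printing Implicit Defensive.

Import Order.TTheory GRing.Theory Num.Theory.

Local Open Scope classical_set_scope.
Local Open Scope group_scope.

(** * Twisted conjugacy invariants *)

Lemma infinite_reidemeister (G : groupType) (phi psi : G -> G) (T : Type)
    (tau : G -> T) (x : nat -> G) :
    phi 1 = 1 -> psi 1 = 1 ->
    (forall y z, twisted_conj phi psi y z -> tau y = tau z) ->
    injective (fun k => tau (x k)) ->
  infinite_set (reidemeister_classes phi psi).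
Proof.
move=> phi1 psi1 tauP tau_inj.
pose c y := [set z | twisted_conj phi psi y z].
have c_inj : injective (fun k => c (x k)).
  move=> i j cij; apply: tau_inj; apply: esym; apply: tauP.
  suff: c (x j) (x i) by [].
  by rewrite -cij; exists 1; rewrite phi1 psi1 invg1 mulg1 mul1g.
move=> fin; apply: infinite_nat.
have -> : [set: nat] = (fun k => c (x k)) @^-1` reidemeister_classes phi psi.
  by apply/seteqP; split=> // k _; exists (x k).
by apply: finite_preimage fin => i j _ _; exact: c_inj.
Qed.

(** * The affine group *)

(** The pair (k, x) stands for the affine map t |-> t * q ^ k + x, and maps are
    composed from left to right. The integer k is kept in place of the ratio
    q ^ k so that the exponent is a projection. *)
Definition affine (F : fieldType) (q : F) (q0 : q != 0%R) : Type :=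
  (int * F)%type.

Section Affine.
Variables (F : fieldType) (q : F) (q0 : q != 0%R).
Local Notation A := (affine q0).

HB.instance Definition _ := Choice.on A.

Definition aff_one : A := (0, 0)%R.
Definition aff_mul (u v : A) : A := (u.1 + v.1, u.2 * q ^ v.1 + v.2)%R.
Definition aff_inv (u : A) : A := (- u.1, - (u.2 * q ^ (- u.1)))%R.

Lemma aff_mulA : associative aff_mul.
Proof.
move=> [i x] [j y] [k z]; rewrite /aff_mul /=; congr pair.
  exact: addrA.
by rewrite expfzDr // mulrDl mulrA addrA.
Qed.

Lemma aff_mul1 : left_id aff_one aff_mul.
Proof. by move=> [i x]; rewrite /aff_mul /= mul0r !add0r. Qed.

Lemma aff_mulr1 : right_id aff_one aff_mul.
Proof. by move=> [i x]; rewrite /aff_mul /= expr0z mulr1 !addr0. Qed.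

Lemma aff_mulV : left_inverse aff_one aff_inv aff_mul.
Proof.
move=> [i x]; rewrite /aff_mul /aff_inv /= addNr mulNr -mulrA -expfzDr //.
by rewrite addNr expr0z mulr1 addNr.
Qed.

Lemma aff_mulrV : right_inverse aff_one aff_inv aff_mul.
Proof. by move=> [i x]; rewrite /aff_mul /aff_inv /= !subrr. Qed.

HB.instance Definition _ :=
  isGroup.Build A aff_mulA aff_mul1 aff_mulr1 aff_mulV aff_mulrV.

Lemma affM (u v : A) : u * v = (u.1 + v.1, u.2 * q ^ v.1 + v.2)%R :> A.
Proof. by []. Qed.

Lemma affV (u : A) : u^-1 = (- u.1, - (u.2 * q ^ (- u.1)))%R :> A.
Proof. by []. Qed.

Lemma affX1 (u : A) m : (u ^+ m).1 = (u.1 *+ m)%R.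
Proof. by elim: m => // m IH; rewrite expgS /= IH mulrS. Qed.

Lemma affX_homothety (k : int) m :
  ((k, 0)%R : A) ^+ m = ((k *+ m)%R, 0%R) :> A.
Proof.
by elim: m => // m IH; rewrite expgS IH affM /= mul0r addr0 mulrS.
Qed.

Lemma affX_translation (x : F) m :
  ((0%R, x) : A) ^+ m = (0%R, (x *+ m)%R) :> A.
Proof.
elim: m => // m IH.
by rewrite expgS IH affM /= expr0z mulr1 addr0 mulrS.
Qed.

End Affine.

(** * The normal form *)

Section NormalForm.
Variable n : nat.
Local Notation a := (BSa n).
Local Notation b := (BSb n).

Lemma BS_ind (P : BS n -> Prop) :
    P 1 -> (forall g, P g -> P (a * g)) -> (forall g, P g -> P (a^-1 * g)) ->
    (forall g, P g -> P (b * g)) -> (forall g, P g -> P (b^-1 * g)) ->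
  forall g, P g.
Proof.
move=> P1 Pa PaV Pb PbV g; rewrite -(pcl_repr g).
elim: (repr g) => [|[[] []] w IH]; first exact: P1.
all: rewrite -cat1s pclM.
- suff -> : pcl (BS_rels n) [:: (true, true)] = a^-1 by exact: PaV.
  by rewrite -pclV.
- exact: Pa.
- suff -> : pcl (BS_rels n) [:: (false, true)] = b^-1 by exact: PbV.
  by rewrite -pclV.
- exact: Pb.
Qed.

Lemma BS_mulbXa m : b ^+ m * a = a * b ^+ (n * m)%N.
Proof.
have ba : b * a = a * b ^+ n by rewrite -BS_relation !mulgA mulgV mul1g.
elim: m => [|m IH]; first by rewrite muln0 !expg0 mul1g mulg1.
by rewrite expgS -mulgA IH mulgA ba -mulgA -expgnDr mulnS.
Qed.

Lemma BS_mulbaX i : b * a ^+ i = a ^+ i * b ^+ (n ^ i)%N.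
Proof.
elim: i => [|i IH]; first by rewrite expn0 expg0 expg1 mul1g mulg1.
by rewrite expgSr mulgA IH -mulgA BS_mulbXa mulgA expnS.
Qed.

Lemma BS_mulaVbX m : a^-1 * b ^+ m = b ^+ (n * m)%N * a^-1.
Proof. by apply: (mulgI a); rewrite mulVKg mulgA -BS_mulbXa mulgK. Qed.

(** The relation lets positive powers of a move to the left of b and negative
    ones to its right, at the cost of raising b to powers of n. The integral
    power of b is written as b ^+ k * b ^- l. *)
Lemma BS_normal_form (g : BS n) :
  exists i j k l, g = a ^+ i * (b ^+ k * b ^- l) * a ^- j.
Proof.
elim/BS_ind: g => [|_ [i [j [k [l ->]]]]|_ [i [j [k [l ->]]]]
                   |_ [i [j [k [l ->]]]]|_ [i [j [k [l ->]]]]].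
- by exists 0, 0, 0, 0; rewrite !expg0 invg1 !mulg1.
- by exists i.+1, j, k, l; rewrite expgS !mulgA.
- case: i => [|i]; last by exists i, j, k, l; rewrite expgS !mulgA mulVg mul1g.
  exists 0, j.+1, (n * k)%N, (n * l)%N; rewrite !expg0 !mul1g.
  rewrite expgSr invgM !mulgA BS_mulaVbX; congr (_ * _).
  rewrite -!mulgA; congr (_ * _); apply: (mulgI (b ^+ (n * l)%N)).
  by rewrite mulVKg mulgA -BS_mulaVbX mulgK.
- exists i, j, (n ^ i + k)%N, l.
  by rewrite !mulgA BS_mulbaX expgnDr !mulgA.
- exists i, j, k, (n ^ i + l)%N.
  have -> : b^-1 * (a ^+ i * (b ^+ k * b ^- l) * a ^- j)
          = (b^-1 * a ^+ i) * (b ^+ k * b ^- l) * a ^- j by rewrite !mulgA.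
  have -> : b^-1 * a ^+ i = a ^+ i * b ^- (n ^ i)%N.
    by apply: (mulgI b); rewrite mulVKg mulgA BS_mulbaX mulgK.
  congr (_ * _); rewrite -mulgA; congr (_ * _).
  rewrite mulgA addnC expgnDr invgM mulgA; congr (_ * _).
  apply: (mulgI (b ^+ (n ^ i)%N)); rewrite mulVKg !mulgA -expgnDr addnC expgnDr.
  by rewrite mulgK.
Qed.

End NormalForm.

(** * The affine representation *)

Lemma affine_rep (n : nat) (q0 : (n%:R != 0 :> rat)%R) :
  exists rho : UMagmaMorphism.type (BS n) (affine q0),
    [/\ injective rho, rho (BSa n) = (1, 0)%R & rho (BSb n) = (0, 1)%R].
Proof.
pose f (x : bool) : affine q0 := if x then (1, 0)%R else (0, 1)%R.
have f_rels u v : BS_rels n u v -> weval f u = weval f v.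
  case=> -> ->.
  have -> m : weval f (nseq m (false, false)) = f false ^+ m.
    by elim: m => // m IH; rewrite expgS -IH.
  rewrite /f affX_translation /= mulg1 affV !affM /=.
  by rewrite mul0r oppr0 mul0r expr1z mul1r addr0 !add0r.
have [F [[FM F_gen] _]] := pres_universal f_rels.
have F1 : F 1 = 1 by apply: (mulgI (F 1)); rewrite -FM !mulg1.
pose mix := isUMagmaMorphism.Build (BS n) (affine q0) F (F1, FM).
pose rho : UMagmaMorphism.type (BS n) (affine q0) := HB.pack F mix.
have rhoa : rho (BSa n) = (1, 0)%R := F_gen true.
have rhob : rho (BSb n) = (0, 1)%R := F_gen false.
exists rho; split=> // x y /(congr1 (fun u => u / rho y)).
rewrite mulgV -gmulfF => ker; apply: divg1_eq; move: ker.
have [i [j [k [l ->]]]] := BS_normal_form (x / y).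
rewrite !(gmulfM, gmulfV, gmulfXn) rhoa rhob !affX_homothety !affX_translation.
rewrite !affV !affM /= => -[].
rewrite !(oppr0, mul0r, expr0z, mulr1, addr0, add0r) => eij.
move/eqP; rewrite mulf_eq0 expfz_eq0 (negPf q0) andbF orbF.
rewrite subr_eq0 eqr_nat => /eqP ->.
move/eqP: eij; rewrite subr_eq0 eqr_nat => /eqP ->.
by rewrite mulgV mulg1 mulgV.
Qed.

(** * Injective endomorphisms preserve the exponent *)

(** Conjugation by u multiplies translations by n ^ u.1, so a nontrivial v can
    only be conjugated to its n-th power by an affine map of ratio n. *)
Lemma aff_relation_exponent (n : nat) (n_gt1 : 1 < n)
    (q0 : (n%:R != 0 :> rat)%R) (u v : affine q0) :
  v != 1 -> u^-1 * v * u = v ^+ n -> v.1 = 0%R /\ u.1 = 1%R.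
Proof.
case: u v => [k y] [t x] v1 uv.
have t0 : t = 0%R.
  move/(congr1 fst): (uv); rewrite affX1 affV !affM /=.
  rewrite addrAC addNr add0r => /eqP.
  rewrite eq_sym -subr_eq0 -{2}[t]mulr1n -mulrnBr; last exact: ltnW.
  by rewrite mulrn_eq0 subn_eq0 leqNgt n_gt1 => /eqP.
split=> //; move: uv v1; rewrite {}t0 affX_translation affV !affM /=.
rewrite expr0z mulr1 => -[_ xk].
have {}xk : (x * n%:R ^ k = x * n%:R ^ (1 : int))%R.
  move: xk; rewrite mulrDl mulNr -mulrA -expfzDr // addNr expr0z mulr1.
  by rewrite expr1z mulr_natr addrAC addNr add0r.
case: (eqVneq x 0%R) => [-> /eqP|x0 _]; first by [].
have n_neq1 : (n%:R != 1 :> rat)%R by rewrite pnatr_eq1 gtn_eqF.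
have n_gt0 : (0 < n%:R :> rat)%R by rewrite ltr0n ltnW.
exact: (ieexprIz n_gt0 n_neq1 (mulfI x0 xk)).
Qed.

Lemma inj_endo_exponent (n : nat) (n_gt1 : 1 < n) (q0 : (n%:R != 0 :> rat)%R)
    (rho : UMagmaMorphism.type (BS n) (affine q0))
    (phi : UMagmaMorphism.type (BS n) (BS n)) :
    injective rho -> rho (BSa n) = (1, 0)%R -> rho (BSb n) = (0, 1)%R ->
    injective phi ->
  forall g, (rho (phi g)).1 = (rho g).1.
Proof.
move=> rho_inj rhoa rhob phi_inj.
have b1 : rho (phi (BSb n)) != 1.
  by rewrite gmulf_eq1 // gmulf_eq1 // -(gmulf_eq1 _ rho_inj) rhob.
have [eb ea] : (rho (phi (BSb n))).1 = 0%R /\ (rho (phi (BSa n))).1 = 1%R.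
  apply: aff_relation_exponent => //.
  by rewrite -gmulfV -!gmulfM -gmulfXn -gmulfV -!gmulfM -gmulfXn BS_relation.
elim/BS_ind => [|g IH|g IH|g IH|g IH].
- by rewrite !gmulf1.
all: rewrite !(gmulfM, gmulfV) /= IH.
- by rewrite ea rhoa.
- by rewrite ea rhoa.
- by rewrite eb rhob.
- by rewrite eb rhob.
Qed.

(** * Infinitely many classes *)

Theorem theorem5p5 (n : nat) (hn : 1 < n)
    (phi psi : UMagmaMorphism.type (BS n) (BS n))
    (phi_inj : injective phi) (psi_inj : injective psi) :
  infinite_set (reidemeister_classes phi psi).
Proof.
have q0 : (n%:R != 0 :> rat)%R by rewrite pnatr_eq0 -lt0n ltnW.
have [rho [rho_inj rhoa rhob]] := affine_rep q0.
have expE (f : UMagmaMorphism.type (BS n) (BS n)) (f_inj : injective f) :=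
  inj_endo_exponent hn rho_inj rhoa rhob f_inj.
apply: (@infinite_reidemeister _ _ _ _ (fun g => (rho g).1)
          (fun k => BSa n ^+ k)); rewrite ?gmulf1 //.
  move=> x _ [g ->].
  by rewrite !gmulfM gmulfV /= !expE // addrAC subrr add0r.
move=> i j /=; rewrite !gmulfXn rhoa !affX_homothety /= => /eqP.
by rewrite eqr_nat => /eqP.
Qed.
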